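(* Let $\gamma>0$ be a given disturbance attenuation level. Consider the affine nonlinear stochastic system $$x_{k+1}=f_1(x_k)+h_1(x_k)v_k+[f_2(x_k)+h_2(x_k)v_k]w_k,\quad y_k=g_1(x_k)+g_2(x_k)v_k,\quad z_k=m(x_k),\quad k\in\mathcal N,$$ the filter $$\hat x_{k+1}=\hat f(\hat x_k)+\hat g(\hat x_k)y_k,\quad \hat z_k=\hat m(\hat x_k),\quad k\in\mathcal N,$$ and the augmented system in $\eta_k=\begin{bmatrix}x_k\\ \hat x_k\end{bmatrix}\in\mathcal R^{n_\eta}$, $$\eta_{k+1}=\tilde f_1(\eta_k)+\tilde h_1(\eta_k)v_k+[\tilde f_2(\eta_k)+\tilde h_2(\eta_k)v_k]w_k,\quad \tilde z_k=z_k-\hat z_k=\tilde m(\eta_k),$$ where for $\eta=\begin{bmatrix}x\\ \hat x\end{bmatrix}$ $$\tilde f_1(\eta)=\begin{bmatrix}f_1(x)\\ \hat f(\hat x)+\hat g(\hat x)g_1(x)\end{bmatrix},\ \tilde f_2(\eta)=\begin{bmatrix}f_2(x)\\0\end{bmatrix},\ \tilde h_1(\eta)=\begin{bmatrix}h_1(x)\\ \hat g(\hat x)g_2(x)\end{bmatrix},\ \tilde h_2(\eta)=\begin{bmatrix}h_2(x)\\0\end{bmatrix},\ \tilde m(\eta)=m(x)-\hat m(\hat x).$$ Suppose $\eta\mapsto\|\tilde m(\eta)\|$ is a continuous positive radially unbounded function, and suppose there exists $(Q,\hat f,\hat g,\hat m)$, with $Q$ a positive definite real symmetric matrix, such that for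 all $\eta\in\mathcal R^{n_\eta}$ and $v\in\mathcal R^{n_v}$ $$2\Theta_1+\bar\Theta_2-\eta'Q\eta+\|\tilde m(\eta)\|^2\le0,$$ where $$\Theta_1=\tilde f_1'(\eta)Q\tilde f_1(\eta)+\tilde f_2'(\eta)Q\tilde f_2(\eta),\qquad \bar\Theta_2=v'\big(2\tilde h_1'(\eta)Q\tilde h_1(\eta)+2\tilde h_2'(\eta)Q\tilde h_2(\eta)-\gamma^2I\big)v.$$ Then the filter is a desired $H_\infty$ filter of the system, i.e. the augmented system is both internally stable and externally stable (with level $\gamma$).
   Context: $'$ denotes transpose. $\mathcal N=\{0,1,2,\dots\}$. $\{w_k\}_{k\in\mathcal N}$ is a sequence of independent real-valued random variables on a complete probability space $(\Omega,\mathcal F,\mathcal P)$ with $E[w_i]=0$ and $E[w_iw_j]=\delta_{ij}$ (Kronecker delta); $\mathcal F_0=\{\emptyset,\Omega\}$, $\mathcal F_k=\sigma(w_0,\dots,w_{k-1})$. $l^2_\infty(\Omega,\mathcal F,\{\mathcal F_k\},\mathcal R^{n_v})$ is the space of $\mathcal F_k$-adapted sequences $v=\{v_k\}$ with $\|v\|^2_{l^2_\infty}=E\sum_{k\ge0}\|v_k\|^2<\infty$. Dimensions: $x_k\in\mathcal R^n$, $y_k\in\mathcal R^{n_y}$, $z_k\in\mathcal R^{n_z}$, $v_k\in\mathcal R^{n_v}$, $\hat x_k\in\mathcal R^{n_{\hat x}}$; $f_1,f_2$ are $\mathcal R^n$-valued, $h_1,h_2$ are $\mathcal R^{n\times n_v}$-valued,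 $g_1$ is $\mathcal R^{n_y}$-valued, $g_2$ is $\mathcal R^{n_y\times n_v}$-valued, $m$ is $\mathcal R^{n_z}$-valued, all continuous; $\hat f$ is $\mathcal R^{n_{\hat x}}$-valued, $\hat g$ is $\mathcal R^{n_{\hat x}\times n_y}$-valued, $\hat m$ is $\mathcal R^{n_z}$-valued, all Borel measurable. The system is a special case of a general system $x_{k+1}=f(x_k,w_k,v_k)$, $y_k=g(x_k,v_k)$, $z_k=m(x_k,v_k)$ with $f(0,0,0)=0$, $g(0,0)=0$, $m(0,0)=0$. A positive radially unbounded function $U$ on $\mathcal R^{n_\eta}$: $U(0)=0$, $U(\eta)>0$ for $\eta\ne0$, $\liminf_{\|\eta\|\to\infty}U(\eta)=\infty$. Internally stable: with $v\equiv0$, the solution $\eta_k^{0,\eta_0,0}$ of the augmented system starting at time $0$ from deterministic $\eta_0\in\mathcal R^{n_\eta}$ satisfies: for every $\varepsilon>0$, $\lim_{\eta_0\to0}\mathcal P(\sup_{k\ge0}\|\eta_k^{0,\eta_0,0}\|>\varepsilon)=0$; and $\mathcal P(\lim_{k\to\infty}\eta_k^{0,\eta_0,0}=0)=1$ for every $\eta_0$. Externally stable (level $\gamma$): for every nonzero $v\in l^2_\infty(\Omega,\mathcal F,\{\mathcal F_k\},\mathcal R^{n_v})$ and $\eta_0=0$, $\|\tilde z\|^2_{l^2_\infty}\le\gamma^2\|v\|^2_{l^2_\infty}$. *)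

(* Defs.v *)
From mathcomp Require Import all_boot all_order all_algebra.
From mathcomp Require Import finmap.
From mathcomp Require Import all_classical all_reals all_analysis.
Set Implicit Arguments.
Unset Strict Implicit.
Unset Printing Implicit Defensive.
Import Order.TTheory GRing.Theory Num.Theory.
Import numFieldNormedType.Exports.
Local Open Scope classical_set_scope.
Local Open Scope ring_scope.

Section euclidean.
Variable R : realType.

(* The library norm on matrices is the sup norm; this is the Euclidean one.
   Both induce the topology carried by 'cV[R]_n. *)
Definition enorm n (x : 'cV[R]_n) : R := Num.sqrt (\sum_(i < n) x i 0 ^+ 2).

Definition qform n (Q : 'M[R]_n) (x : 'cV[R]_n) : R := (x^T *m Q *m x) 0 0.

Definition sym_posdef n (Q : 'M[R]_n) : Prop :=
  Q^T = Q /\ forall x : 'cV[R]_n, x != 0 -> 0 < qform Q x.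

Definition borel_measurable (T U : ptopologicalType) (f : T -> U) : Prop :=
  @measurable_fun _ _ (g_sigma_algebraType (@open T))
    (g_sigma_algebraType (@open U)) setT f.

(* Neighbourhoods of infinity, i.e. the filter of ||x|| --> oo. *)
Definition enorm_infty n : set_system 'cV[R]_n :=
  filter_from setT (fun r : R => [set x | r < enorm x]).

Definition positive_radially_unbounded n (U : 'cV[R]_n -> R) : Prop :=
  [/\ U 0 = 0,
      forall x, x != 0 -> 0 < U x &
      limf_einf (fun x => (U x)%:E) (@enorm_infty n) = +oo%E].

End euclidean.

Section noise.
Variables (R : realType) (d : measure_display) (Omega : measurableType d).
Variables (P : probability Omega R).

Definition mutually_independent (w : nat -> {RV P >-> R}) : Prop :=
  forall (J : {fset nat}) (B : nat -> set R), (forall i, measurable (B i)) ->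
    P (\bigcap_(i in [set` J]) (w i @^-1` B i)) =
    (\prod_(i <- J) P (w i @^-1` B i))%E.

(* F_k = sigma(w_0, ..., w_{k-1}); for k = 0 it is {set0, setT}. *)
Definition past (w : nat -> {RV P >-> R}) (k : nat) : set_system Omega :=
  g_sigma_preimage (fun i : 'I_k => (w i : Omega -> R)).

Definition adapted (w : nat -> {RV P >-> R}) n
    (v : nat -> Omega -> 'cV[R]_n) : Prop :=
  forall k (B : set 'cV[R]_n),
    (@open 'cV[R]_n).-sigma.-measurable B -> past w k (v k @^-1` B).

Definition sqr_l2norm n (v : nat -> Omega -> 'cV[R]_n) : \bar R :=
  (\int[P]_om \sum_(0 <= k <oo) ((enorm (v k om)) ^+ 2)%:E)%E.

Definition l2_process (w : nat -> {RV P >-> R}) n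
    (v : nat -> Omega -> 'cV[R]_n) : Prop :=
  adapted w v /\ (sqr_l2norm v < +oo)%E.

End noise.

(* x_{k+1} = f1(x_k) + h1(x_k) v_k + [f2(x_k) + h2(x_k) v_k] w_k,
   y_k = g1(x_k) + g2(x_k) v_k,  z_k = m(x_k). *)
Record plant (R : realType) (n nv ny nz : nat) := Plant {
  f1 : 'cV[R]_n -> 'cV[R]_n;
  f2 : 'cV[R]_n -> 'cV[R]_n;
  h1 : 'cV[R]_n -> 'M[R]_(n, nv);
  h2 : 'cV[R]_n -> 'M[R]_(n, nv);
  g1 : 'cV[R]_n -> 'cV[R]_ny;
  g2 : 'cV[R]_n -> 'M[R]_(ny, nv);
  m_out : 'cV[R]_n -> 'cV[R]_nz }.

(* xh_{k+1} = fh(xh_k) + gh(xh_k) y_k,  zh_k = mh(xh_k). *)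
Record estimator (R : realType) (nxh ny nz : nat) := Estimator {
  fh : 'cV[R]_nxh -> 'cV[R]_nxh;
  gh : 'cV[R]_nxh -> 'M[R]_(nxh, ny);
  mh : 'cV[R]_nxh -> 'cV[R]_nz }.

Section augmented.
Variables (R : realType) (n nv ny nz nxh : nat).
Variables (Sys : plant R n nv ny nz) (F : estimator R nxh ny nz).

Definition plant_step (x : 'cV[R]_n) (w : R) (v : 'cV[R]_nv) : 'cV[R]_n :=
  f1 Sys x + h1 Sys x *m v + w *: (f2 Sys x + h2 Sys x *m v).

Definition plant_meas (x : 'cV[R]_n) (v : 'cV[R]_nv) : 'cV[R]_ny :=
  g1 Sys x + g2 Sys x *m v.

Definition plant_continuous : Prop :=
  [/\ continuous (f1 Sys), continuous (f2 Sys), continuous (h1 Sys) &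
      continuous (h2 Sys)] /\
  [/\ continuous (g1 Sys), continuous (g2 Sys) & continuous (m_out Sys)].

Definition plant_vanishing : Prop :=
  [/\ plant_step 0 0 0 = 0, plant_meas 0 0 = 0 & m_out Sys 0 = 0].

Definition estimator_measurable : Prop :=
  [/\ borel_measurable (fh F), borel_measurable (gh F) &
      borel_measurable (mh F)].

Definition aug_f1 (eta : 'cV[R]_(n + nxh)) : 'cV[R]_(n + nxh) :=
  let x := usubmx eta in let xh := dsubmx eta in
  col_mx (f1 Sys x) (fh F xh + gh F xh *m g1 Sys x).

Definition aug_f2 (eta : 'cV[R]_(n + nxh)) : 'cV[R]_(n + nxh) :=
  col_mx (f2 Sys (usubmx eta)) 0.

Definition aug_h1 (eta : 'cV[R]_(n + nxh)) : 'M[R]_(n + nxh, nv) :=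
  let x := usubmx eta in let xh := dsubmx eta in
  col_mx (h1 Sys x) (gh F xh *m g2 Sys x).

Definition aug_h2 (eta : 'cV[R]_(n + nxh)) : 'M[R]_(n + nxh, nv) :=
  col_mx (h2 Sys (usubmx eta)) 0.

Definition aug_m (eta : 'cV[R]_(n + nxh)) : 'cV[R]_nz :=
  m_out Sys (usubmx eta) - mh F (dsubmx eta).

Definition aug_step (eta : 'cV[R]_(n + nxh)) (w : R) (v : 'cV[R]_nv) :=
  aug_f1 eta + aug_h1 eta *m v + w *: (aug_f2 eta + aug_h2 eta *m v).

Definition Theta1 (Q : 'M[R]_(n + nxh)) (eta : 'cV[R]_(n + nxh)) : R :=
  qform Q (aug_f1 eta) + qform Q (aug_f2 eta).

Definition Theta2bar (gamma : R) (Q : 'M[R]_(n + nxh))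
    (eta : 'cV[R]_(n + nxh)) (v : 'cV[R]_nv) : R :=
  qform (2 *: ((aug_h1 eta)^T *m Q *m aug_h1 eta)
         + 2 *: ((aug_h2 eta)^T *m Q *m aug_h2 eta)
         - (gamma ^+ 2)%:M) v.

Section trajectories.
Variables (d : measure_display) (Omega : measurableType d).
Variables (P : probability Omega R) (w : nat -> {RV P >-> R}).

Fixpoint aug_state (eta0 : 'cV[R]_(n + nxh)) (v : nat -> Omega -> 'cV[R]_nv)
    (k : nat) (om : Omega) : 'cV[R]_(n + nxh) :=
  if k is j.+1 then aug_step (aug_state eta0 v j om) (w j om) (v j om)
  else eta0.

Definition internally_stable : Prop :=
  let sol eta0 := aug_state eta0 (fun _ _ => 0) in
  (forall eps : R, 0 < eps ->
     P [set om | (eps%:E < ereal_sup [set (enorm (sol eta0 k om))%:E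
                                     | k in [set: nat]])%E]
       @[eta0 --> (0 : 'cV[R]_(n + nxh))^'] --> 0%E) /\
  (forall eta0 : 'cV[R]_(n + nxh),
     P [set om | sol eta0 k om @[k --> \oo] --> (0 : 'cV[R]_(n + nxh))] = 1%E).

(* "v nonzero" is meant in the Hilbert space of processes, i.e. up to
   almost sure equality. *)
Definition externally_stable (gamma : R) : Prop :=
  forall v : nat -> Omega -> 'cV[R]_nv,
    l2_process w v -> sqr_l2norm P v != 0%E ->
    (sqr_l2norm P (fun k om => aug_m (aug_state 0 v k om)) <=
       (gamma ^+ 2)%:E * sqr_l2norm P v)%E.

Definition Hinf_filter (gamma : R) : Prop :=
  internally_stable /\ externally_stable gamma.

End trajectories.
End augmented.

(* Main.v *)
Require Import Defs.
From HB Require Import structures.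
From mathcomp Require Import all_boot all_order all_algebra.
From mathcomp Require Import all_classical all_reals all_analysis.
From mathcomp Require Import finmap measurable_realfun ring lra.
Import Order.TTheory GRing.Theory Num.Theory.
Import numFieldNormedType.Exports.
Local Open Scope classical_set_scope.
Local Open Scope ring_scope.

(** The function [V eta = eta' Q eta] is a stochastic storage function. Since
    [V (a + b) <= 2 V a + 2 V b], the matrix inequality bounds
    [V (drift) + V (diffusion) + |m~|^2] by [V eta + gamma^2 |v|^2], and, [w k]
    being standardized and independent of the past, [V (drift) + V (diffusion)]
    has the same expectation as [V eta_{k+1}]. Telescoping gives
    [E sum_k |m~(eta_k)|^2 <= V eta_0 + gamma^2 E sum_k |v_k|^2], which is external
    stability when [eta_0 = 0]. For [v = 0], neither Doob's maximal inequality
    nor martingale convergence is needed: outside any ball [|m~|] is bounded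
    below by some [delta > 0], so Markov's inequality gives
    [P (sup_k |eta_k| > eps) <= V eta_0 / delta^2], and almost sure finiteness of
    [sum_k |m~(eta_k)|^2] forces [eta_k --> 0]. *)

(** * Borel measurability of matrix-valued maps *)

(** Working entrywise reduces matrix algebra to closure properties of real functions. The source
    sigma-algebra is a parameter so that it can also be the past sigma-algebra. *)
Definition measurable_mx {R : realType} {d} {T : measurableType d} {m n : nat}
    (X : T -> 'M[R]_(m, n)) : Prop :=
  forall i j, measurable_fun setT (fun t => X t i j).

(** Second countability: an open set is a countable union of boxes with rational centre and radius
    [1 / (k + 1)], and the preimage of a box is a finite intersection of entrywise conditions. *)
Lemma mx_preimage_measurable {R : realType} {d} {T : measurableType d} {m n : nat}
    {X : T -> 'M[R]_(m, n)} :
  measurable_mx X ->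
  forall B : set 'M[R]_(m, n), (@open 'M[R]_(m, n)).-sigma.-measurable B ->
  measurable (X @^-1` B).
Proof.
move=> mX B mB.
pose box (c : 'M[rat]_(m, n) * nat) :=
  [set x : 'M[R]_(m, n) | forall i j, `|x i j - ratr (c.1 i j)| < c.2.+1%:R^-1].
have mbox c : measurable (X @^-1` box c).
  have -> : X @^-1` box c = \bigcap_(ij in [set: 'I_m * 'I_n])
      [set t | `|X t ij.1 ij.2 - ratr (c.1 ij.1 ij.2)| < c.2.+1%:R^-1].
    by apply/seteqP; split => [t /= h [i j] _ /=|t h i j]; [exact: h|exact: (h (i, j))].
  apply: fin_bigcap_measurable => [|[i j] _ /=]; first exact: finite_finset.
  rewrite -[X in measurable X]setTI.
  have mf : measurable_fun setT (fun t => `|X t i j - ratr (c.1 i j)|).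
    apply: measurableT_comp => //; apply: measurable_funB => //.
  have := mf measurableT _ (measurable_itv `]-oo, c.2.+1%:R^-1[).
  by rewrite set_itvNyo.
have mO (O : set 'M[R]_(m, n)) : open O -> measurable (X @^-1` O).
  move=> oO.
  (* The union runs over the countable type of all centres and radii; boxes that leave [O]
     contribute the empty set. *)
  have -> : X @^-1` O = \bigcup_c (if `[< box c `<=` O >] then X @^-1` box c else set0).
    apply/seteqP; split => t /=; last first.
      by case=> c _; case: asboolP => // cO; exact: cO.
    move=> Ot.
    have /nbhs_ballP[e /= e0 eO] : nbhs (X t) O by exact: open_nbhs_nbhs.
    (* The centre lies within the radius of [X t], and so does any point of the box from the centre;
       a radius below [e / 2] keeps the box inside the [e]-ball. *)
    have e20 : 0 < e / 2 by rewrite divr_gt0.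
    pose k := Num.truncn (e / 2)^-1.
    have ke : k.+1%:R^-1 < e / 2.
      by rewrite invf_plt ?posrE// truncnS_gt.
    have k0 : 0 < (k.+1%:R^-1 : R) by rewrite invr_gt0.
    (* [lra] does not treat [k.+1%:R^-1] as an atom *)
    have [r rE] : exists r : R, r = k.+1%:R^-1 by eexists.
    rewrite -rE in ke k0.
    have /choice[q qP] ij : exists q, `|X t ij.1 ij.2 - ratr q| < r.
      have /rat_in_itvoo[q] : X t ij.1 ij.2 - r < X t ij.1 ij.2 + r by lra.
      rewrite in_itv /= => /andP[q1 q2]; exists q.
      by rewrite ltr_norml; apply/andP; split; lra.
    exists (\matrix_(i, j) q (i, j), k) => //.
    case: asboolP => [_ i j /=|[]]; first by rewrite mxE -rE; exact: qP (i, j).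
    move=> y /= yk; apply: eO; split => // i j.
    rewrite -ball_normE /=.
    have := yk i j; rewrite mxE -rE => yij; have := qP (i, j) => /= xij.
    have -> : X t i j - y i j =
        (X t i j - ratr (q (i, j))) - (y i j - ratr (q (i, j))) by ring.
    rewrite (le_lt_trans (ler_normB _ _))//.
    by move: (ltrD xij yij) => /lt_le_trans; apply; lra.
  apply: countable_bigcupT_measurable => // c.
  by case: ifP.
(* Sets with measurable preimage form a sigma-algebra, which contains the open sets by [mO]. *)
suff : (@open 'M[R]_(m, n)).-sigma.-measurable `<=` [set A | measurable (X @^-1` A)].
  exact.
apply: smallest_sub => //; split => /= [|A mA|F mF].
- by rewrite preimage_set0.
- by rewrite setTD preimage_setC; exact: measurableC.
- by rewrite preimage_bigcup; exact: bigcupT_measurable.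
Qed.

Lemma measurable_continuous_mx {R : realType} {d} {T : measurableType d} {m n : nat}
    {X : T -> 'M[R]_(m, n)} {f : 'M[R]_(m, n) -> R} :
  measurable_mx X -> continuous f ->
  measurable_fun setT (fun t => f (X t)).
Proof.
move=> mX /continuousP cf.
apply: (measurability _ (RGenOpens.measurableE R)) => _ [_ [a [b ->]] <-].
rewrite setTI; apply: (mx_preimage_measurable mX (f @^-1` `]a, b[)).
by apply: sub_sigma_algebra; apply: cf; exact: interval_open.
Qed.

(** Converse of [mx_preimage_measurable], by continuity of the entries; it turns the Borel
    formulation in [adapted] into the entrywise one. *)
Lemma measurable_borel_entry {R : realType} {d} {T : measurableType d} {m n : nat}
    {X : T -> 'M[R]_(m, n)} :
  (forall B : set 'M[R]_(m, n), (@open 'M[R]_(m, n)).-sigma.-measurable B ->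
    measurable (X @^-1` B)) ->
  measurable_mx X.
Proof.
move=> mX i j.
apply: (measurability _ (RGenOpens.measurableE R)) => _ [_ [a [b ->]] <-].
rewrite setTI; apply: (mX ((fun M : 'M[R]_(m, n) => M i j) @^-1` `]a, b[)).
apply: sub_sigma_algebra.
by move: (@coord_continuous R m n i j) => /continuousP; apply; exact: interval_open.
Qed.

Lemma measurable_borel_mx {R : realType} {d} {T : measurableType d} {m n p q : nat}
    {X : T -> 'M[R]_(m, n)} {f : 'M[R]_(m, n) -> 'M[R]_(p, q)} :
  measurable_mx X -> borel_measurable f ->
  measurable_mx (fun t => f (X t)).
Proof.
move=> mX mf; apply: measurable_borel_entry => B mB.
apply: (mx_preimage_measurable mX (f @^-1` B)).
by rewrite -[X in measurable X]setTI; apply: mf.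
Qed.

Lemma continuous_borel {R : realType} {m n p q : nat}
    {f : 'M[R]_(m, n) -> 'M[R]_(p, q)} : continuous f -> borel_measurable f.
Proof.
move=> /continuousP cf; apply: (@measurability _ _ (g_sigma_algebraType (@open 'M[R]_(m, n)))
  (g_sigma_algebraType (@open 'M[R]_(p, q))) setT f (@open 'M[R]_(p, q))) => //.
move=> _ [B oB <-]; rewrite setTI; apply: sub_sigma_algebra; exact: cf.
Qed.

(** * Independence of the noise from the past *)

(** Independence makes the joint law the product of the marginals, and Tonelli splits the integral;
    nonnegativity of [g] stands in for integrability. *)
Lemma integral_indep_pair {R : realType} {d d1 d2} {Omega : measurableType d}
    {T1 : measurableType d1} {T2 : measurableType d2} {P : probability Omega R}
    {X : Omega -> T1} {Y : Omega -> T2} {g : T1 * T2 -> \bar R} :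
  measurable_fun setT X -> measurable_fun setT Y ->
  (forall A B, measurable A -> measurable B ->
    P (X @^-1` A `&` Y @^-1` B) = (P (X @^-1` A) * P (Y @^-1` B))%E) ->
  measurable_fun setT g -> (forall z, 0 <= g z)%E ->
  (\int[P]_om g (X om, Y om) = \int[P]_om \int[P]_om' g (X om, Y om'))%E.
Proof.
move=> mX mY indep mg g0.
have mXY : measurable_fun setT (fun om => (X om, Y om)) by exact: measurable_fun_pair.
pose X' : {mfun Omega >-> T1} := HB.pack X (isMeasurableFun.Build _ _ _ _ _ mX).
pose Y' : {mfun Omega >-> T2} := HB.pack Y (isMeasurableFun.Build _ _ _ _ _ mY).
pose XY : {mfun Omega >-> (T1 * T2)%type} :=
  HB.pack (fun om => (X om, Y om)) (isMeasurableFun.Build _ _ _ _ _ mXY).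
pose m1 := distribution P X'; pose m2 := distribution P Y'.
transitivity (\int[distribution P XY]_z g z)%E.
  by rewrite ge0_integral_distribution.
transitivity (\int[(m1 \x m2)%E]_z g z)%E.
  (* The joint law and the product law agree on rectangles, hence everywhere. *)
  apply: eq_measure_integral => A mA _; apply/esym.
  apply: product_measure_unique; last by [].
  move=> A1 A2 mA1 mA2.
  exact: (indep A1 A2 mA1 mA2).
rewrite (fubini_tonelli1 g mg g0) ge0_integral_distribution//.
- apply: eq_integral => om _ /=.
  rewrite /fubini_F ge0_integral_distribution//.
  exact: measurableT_comp.
- exact: measurable_fun_fubini_tonelli_F.
- by move=> y; exact: integral_ge0.
Qed.

Section past.
Context {R : realType} {d} {Omega : measurableType d} {P : probability Omega R}.
Variable w : nat -> {RV P >-> R}.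

(** The generating family of [past w k], named so that [g_sigma_algebraType] yields [Omega] equipped
    with F_k as a measurable type. *)
Definition past_generator (k : nat) : set_system Omega :=
  \big[setU/set0]_(i < k) preimage_set_system setT (w i : Omega -> R) measurable.

(** Unlike [past_generator], this family is stable under intersection: it is the pi-system on which
    independence is checked. *)
Definition cylinder (k : nat) : set_system Omega :=
  [set A | exists2 B : nat -> set R, (forall i, measurable (B i)) &
           A = \bigcap_(i < k) (w i @^-1` B i)].

Lemma past_generatorP k A : past_generator k A <->
  exists2 i, (i < k)%N & exists2 B : set R, measurable B & A = w i @^-1` B.
Proof.
rewrite /past_generator.
rewrite -(bigcup_mkord k (fun i => preimage_set_system setT (w i : Omega -> R) measurable)).
split.
  by move=> [i ik [B mB <-]]; exists i => //; exists B => //; rewrite setTI.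
by move=> [i ik [B mB ->]]; exists i => //; exists B => //; rewrite setTI.
Qed.

Lemma past_generator_measurable k : past_generator k `<=` measurable.
Proof.
move=> A /past_generatorP[i _ [B mB ->]].
by rewrite -[X in measurable X]setTI; exact: measurable_funP.
Qed.

Lemma past_sub_measurable k : past w k `<=` measurable.
Proof.
apply: smallest_sub; first exact: sigma_algebra_measurable.
exact: past_generator_measurable.
Qed.

Lemma past_sub_cylinder k : past w k `<=` <<s cylinder k >>.
Proof.
apply: smallest_sub; first exact: smallest_sigma_algebra.
move=> A /past_generatorP[i ik [B mB ->]]; apply: sub_sigma_algebra.
exists (fun j => if j == i then B else setT) => [j|]; first by case: ifP.
apply/seteqP; split => om /=; first by move=> ? j _; case: eqP => // ->.
by move/(_ i ik) => /=; rewrite eqxx.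
Qed.

Lemma cylinder_indep (k : nat) (B : nat -> set R) :
  mutually_independent w -> (forall i, measurable (B i)) ->
  P (\bigcap_(i < k.+1) (w i @^-1` B i)) =
  (P (\bigcap_(i < k) (w i @^-1` B i)) * P (w k @^-1` B k))%E.
Proof.
move=> indep mB.
pose J : {fset nat} := [fset i in iota 0 k]%fset.
have JE i : (i \in J) = (i < k)%N by rewrite !inE mem_iota.
have kJ : k \notin J by rewrite JE ltnn.
have -> : `I_k.+1 = [set` (k |` J)%fset].
  by apply/seteqP; split => i /=; rewrite in_fsetU in_fset1 JE -leq_eqVlt.
have -> : `I_k = [set` J] by apply/seteqP; split => i /=; rewrite JE.
by rewrite !indep// big_fsetU1//= muleC.
Qed.

(** Both sides are finite measures in [A]; they agree on the pi-system of cylinders by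
    [cylinder_indep], hence on the sigma-algebra it generates, which contains [past w k]. *)
Lemma past_indep (k : nat) (A : set Omega) (B : set R) :
  mutually_independent w -> past w k A -> measurable B ->
  P (A `&` w k @^-1` B) = (P A * P (w k @^-1` B))%E.
Proof.
move=> indep pA mB.
have mC : measurable (w k @^-1` B).
  by rewrite -[X in measurable X]setTI; exact: measurable_funP.
have PC : (0 <= fine (P (w k @^-1` B)))%R by exact: fine_ge0.
pose m1 := mrestr P mC; pose m2 := mscale (NngNum PC) P.
have m2E E : (m2 E = P E * P (w k @^-1` B))%E.
  by rewrite /m2 /mscale/= fineK ?fin_num_measure// muleC.
rewrite -m2E -[LHS]/(m1 A).
(* Since the measures are finite, the constant sequence [setT] serves as the exhausting sequence. *)
apply: (g_sigma_algebra_measure_unique (cylinder k) _ (fun=> setT)) => //.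
- move=> _ [C mC' ->]; apply: bigcap_measurableType => i _.
  by rewrite -[X in measurable X]setTI; exact: measurable_funP.
- move=> _; exists (fun=> setT) => //.
  by apply/seteqP; split.
- by rewrite bigcup_const.
- move=> _ _ [C1 mC1 ->] [C2 mC2 ->]; exists (fun i => C1 i `&` C2 i).
    by move=> i; exact: measurableI.
  by rewrite -bigcapI.
- move=> _ [C mC' ->].
  apply: etrans (esym (m2E _)).
  (* Placing [B] at index [k] makes the intersection with the event on [w k] a cylinder of length
     [k.+1]. *)
  pose D i := if i == k then B else C i.
  have := @cylinder_indep k D indep.
  have -> : D k = B by rewrite /D eqxx.
  have -> : \bigcap_(i < k) (w i @^-1` D i) = \bigcap_(i < k) (w i @^-1` C i).
    by apply: eq_bigcapr => i /= ik; rewrite /D ltn_eqF.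
  move=> <-; last by move=> i; rewrite /D; case: ifP.
  congr (P _); apply/seteqP; split => om /=.
    move=> [h1 h2] i /= ik; rewrite /D; case: eqP => [->//|/eqP ik'].
    by apply: h1 => /=; rewrite ltn_neqAle ik' -ltnS.
  move=> h; split.
    by move=> i /= ik; have := h i (ltnW ik); rewrite /= /D ltn_eqF.
  by have := h k (ltnSn k); rewrite /= /D eqxx.
- move=> _; rewrite /m1 /= /mrestr setTI.
  by rewrite ltey_eq fin_num_measure.
- exact: past_sub_cylinder.
Qed.

Lemma past_incr k : past w k `<=` past w k.+1.
Proof.
apply: smallest_sub; first exact: smallest_sigma_algebra.
move=> A /past_generatorP[i ik AB]; apply: sub_sigma_algebra.
by apply/past_generatorP; exists i => //; exact: ltnW.
Qed.

(** Here the first variable of the independent pair is the identity, seen as a map from [Omega] to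
    [Omega] with F_k; the inner integral freezes the past and averages over [w k] alone. *)
Lemma integral_past_indep k (g : Omega * R -> \bar R) :
  mutually_independent w ->
  @measurable_fun _ _ (g_sigma_algebraType (past_generator k) * R)%type (\bar R) setT g ->
  (forall z, 0 <= g z)%E ->
  (\int[P]_om g (om, w k om) = \int[P]_om \int[P]_om' g (om, w k om'))%E.
Proof.
move=> indep mg g0.
apply: (@integral_indep_pair _ _ _ _ _ (g_sigma_algebraType (past_generator k)) R
  P id (w k)) => //.
  by move=> _ A mA; rewrite setTI; exact: (@past_sub_measurable k).
move=> A B mA mB; exact: past_indep.
Qed.

End past.

(** * Measurable matrix operations, quadratic forms and moments *)

Section measurable_mx_closure.
Context {R : realType} {d} {T : measurableType d}.

Lemma measurable_mx_cst m n (A : 'M[R]_(m, n)) : measurable_mx (fun _ : T => A).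
Proof. by move=> i j. Qed.

Lemma measurable_mxD m n (X Y : T -> 'M[R]_(m, n)) :
  measurable_mx X -> measurable_mx Y -> measurable_mx (fun t => X t + Y t).
Proof.
by move=> mX mY i j; under eq_fun do rewrite mxE; exact: measurable_funD.
Qed.

Lemma measurable_mxZ m n (a : T -> R) (X : T -> 'M[R]_(m, n)) :
  measurable_fun setT a -> measurable_mx X -> measurable_mx (fun t => a t *: X t).
Proof.
by move=> ma mX i j; under eq_fun do rewrite mxE; exact: measurable_funM.
Qed.

Lemma measurable_mulmx m n p (X : T -> 'M[R]_(m, n)) (Y : T -> 'M[R]_(n, p)) :
  measurable_mx X -> measurable_mx Y -> measurable_mx (fun t => X t *m Y t).
Proof.
move=> mX mY i j; under eq_fun do rewrite mxE.
by apply: measurable_sum => k; exact: measurable_funM.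
Qed.

Lemma measurable_trmx m n (X : T -> 'M[R]_(m, n)) :
  measurable_mx X -> measurable_mx (fun t => (X t)^T).
Proof. by move=> mX i j; under eq_fun do rewrite mxE; exact: mX. Qed.

Lemma measurable_usubmx m1 m2 n (X : T -> 'M[R]_(m1 + m2, n)) :
  measurable_mx X -> measurable_mx (fun t => usubmx (X t)).
Proof. by move=> mX i j; under eq_fun do rewrite mxE; exact: mX. Qed.

Lemma measurable_dsubmx m1 m2 n (X : T -> 'M[R]_(m1 + m2, n)) :
  measurable_mx X -> measurable_mx (fun t => dsubmx (X t)).
Proof. by move=> mX i j; under eq_fun do rewrite mxE; exact: mX. Qed.

Lemma measurable_col_mx m1 m2 n (X : T -> 'M[R]_(m1, n)) (Y : T -> 'M[R]_(m2, n)) :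
  measurable_mx X -> measurable_mx Y -> measurable_mx (fun t => col_mx (X t) (Y t)).
Proof.
move=> mX mY i j; under eq_fun do rewrite mxE.
by case: (fintype.split i) => k; [exact: mX|exact: mY].
Qed.

Lemma measurable_enorm_sqr n (X : T -> 'cV[R]_n) :
  measurable_mx X -> measurable_fun setT (fun t => enorm (X t) ^+ 2).
Proof.
move=> mX; have -> : (fun t => enorm (X t) ^+ 2) = (fun t => \sum_(i < n) X t i 0 ^+ 2).
  by apply/funext => t; rewrite sqr_sqrtr// sumr_ge0// => i _; exact: sqr_ge0.
by apply: measurable_sum => i; exact: measurable_funX.
Qed.

Lemma measurable_bilinear m (X Y : T -> 'cV[R]_m) (A : 'M[R]_m) :
  measurable_mx X -> measurable_mx Y ->
  measurable_fun setT (fun t => ((X t)^T *m A *m Y t) 0 0).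
Proof.
move=> mX mY; have : measurable_mx (fun t => (X t)^T *m A *m Y t).
  by apply: measurable_mulmx => //; apply: measurable_mulmx;
    [exact: measurable_trmx|exact: measurable_mx_cst].
exact.
Qed.

End measurable_mx_closure.

(** * Quadratic forms *)

Section quadratic_form.
Context {R : realType}.

Lemma enorm_sqr n (x : 'cV[R]_n) : enorm x ^+ 2 = (x^T *m x) 0 0.
Proof.
rewrite /enorm sqr_sqrtr; last by apply: sumr_ge0 => i _; exact: sqr_ge0.
by rewrite mxE; apply: eq_bigr => i _; rewrite mxE expr2.
Qed.

Lemma qform_shift n (Q : 'M[R]_n) (x y : 'cV[R]_n) (t : R) :
  qform Q (x + t *: y) =
  qform Q x + ((x^T *m Q *m y) 0 0 + (y^T *m Q *m x) 0 0) * t + qform Q y * t ^+ 2.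
Proof.
rewrite /qform [(_ + _)^T]linearD /= [(_ *: _)^T]linearZ /= !mulmxDl !mulmxDr.
rewrite -!(scalemxAl, scalemxAr).
by rewrite scalerA !mxE; ring.
Qed.

Lemma qform_ge0 {n} {Q : 'M[R]_n} {x} : sym_posdef Q -> 0 <= qform Q x.
Proof.
move=> [_ Q0]; have [->|/Q0/ltW//] := eqVneq x 0.
by rewrite /qform mulmx0 mxE.
Qed.

(** Parallelogram identity: the right side minus the left side is [qform Q (x - y)]. *)
Lemma qform_le2D n (Q : 'M[R]_n) (x y : 'cV[R]_n) :
  sym_posdef Q -> qform Q (x + y) <= 2 * qform Q x + 2 * qform Q y.
Proof.
move=> Q0; have := qform_ge0 (x := x + (-1) *: y) Q0.
by rewrite -{2}[y]scale1r !qform_shift; lra.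
Qed.

Lemma qform_congruence n p (Q : 'M[R]_n) (H : 'M[R]_(n, p)) v :
  qform (H^T *m Q *m H) v = qform Q (H *m v).
Proof. by rewrite /qform trmx_mul !mulmxA. Qed.

End quadratic_form.

(** * Moments of a random variable with mean 0 and variance 1 *)

Section standardized.
Context {R : realType} {d} {Omega : measurableType d} {P : probability Omega R}.
Variable X : {RV P >-> R}.
Hypotheses (EX0 : ('E_P[X] = 0)%E) (EX1 : ('E_P[(X \* X)%R] = 1)%E).

Let mX : measurable_fun setT X. Proof. exact: measurable_funP. Qed.

Let intX2 : P.-integrable setT (fun om => (X om ^+ 2)%:E).
Proof.
apply/integrableP; split.
  by apply/measurable_EFinP; exact: measurable_funX.
have -> : (\int[P]_om `|(X om ^+ 2)%:E| = 'E_P[(X \* X)%R])%E.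
  rewrite unlock; apply: eq_integral => om _ /=.
  by rewrite ger0_norm ?sqr_ge0// expr2.
by rewrite EX1 ltry.
Qed.

Let intX : P.-integrable setT (fun om => (X om)%:E).
Proof.
have i1 : P.-integrable setT (cst 1%:E : Omega -> \bar R).
  exact: finite_measure_integrable_cst.
(* Domination by [1 + X ^+ 2]; the bound on [|X|] follows from the squares of [X - 1] and [X + 1]
   being nonnegative. *)
apply: le_integrable (integrableD measurableT i1 intX2) => //.
  exact/measurable_EFinP.
move=> om _ /=; rewrite lee_fin.
rewrite [leRHS]ger0_norm; last by have := sqr_ge0 (X om); lra.
by have := sqr_ge0 (X om - 1); have := sqr_ge0 (X om + 1);
  case: (ger0P (X om)) => _; nra.
Qed.

Lemma integral_standardized_quadratic (a b c : R) :
  (\int[P]_om (a + b * X om + c * X om ^+ 2)%:E = (a + c)%:E)%E.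
Proof.
have ia : P.-integrable setT (fun _ : Omega => a%:E).
  exact: finite_measure_integrable_cst.
have ib : P.-integrable setT (fun om : Omega => b%:E * (X om)%:E)%E.
  exact: integrableZl.
have ic : P.-integrable setT (fun om : Omega => c%:E * (X om ^+ 2)%:E)%E.
  exact: integrableZl.
under eq_integral do rewrite !EFinD !EFinM.
rewrite integralD//; last exact: integrableD.
rewrite integralD// !integralZl//.
have -> : (\int[P]_x a%:E = a%:E)%E.
  by rewrite -[RHS]mule1 -(probability_setT P) -integral_cst.
have -> : (\int[P]_x (X x)%:E = 0)%E by rewrite -EX0 unlock.
have -> : (\int[P]_x (X x ^+ 2)%:E = 1)%E.
  by rewrite -EX1 unlock; apply: eq_integral => om _ /=; rewrite expr2.
by rewrite mule0 adde0 mule1.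
Qed.

End standardized.

(** * Energy balance along trajectories *)

Section augmented_measurability.
Context {R : realType} {n nv ny nz nxh : nat}.
Variables (Sys : plant R n nv ny nz) (F : estimator R nxh ny nz).
Hypotheses (cSys : plant_continuous Sys) (mF : estimator_measurable F).
Context {d} {T : measurableType d}.
Variable X : T -> 'cV[R]_(n + nxh).
Hypothesis mX : measurable_mx X.

Let mU : measurable_mx (fun t => usubmx (X t)).
Proof. exact: measurable_usubmx. Qed.

Let mD : measurable_mx (fun t => dsubmx (X t)).
Proof. exact: measurable_dsubmx. Qed.

Lemma measurable_aug_f1 : measurable_mx (fun t => aug_f1 Sys F (X t)).
Proof.
have [[c1 _ _ _] [c2 _ _]] := cSys; have [m1 m2 _] := mF.
apply: measurable_col_mx; first exact: measurable_borel_mx mU (continuous_borel c1).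
apply: measurable_mxD; first exact: measurable_borel_mx mD m1.
apply: measurable_mulmx; first exact: measurable_borel_mx mD m2.
exact: measurable_borel_mx mU (continuous_borel c2).
Qed.

Lemma measurable_aug_f2 : measurable_mx (fun t => aug_f2 Sys (X t)).
Proof.
have [[_ c1 _ _] _] := cSys.
apply: measurable_col_mx; first exact: measurable_borel_mx mU (continuous_borel c1).
exact: measurable_mx_cst.
Qed.

Lemma measurable_aug_h1 : measurable_mx (fun t => aug_h1 Sys F (X t)).
Proof.
have [[_ _ c1 _] [_ c2 _]] := cSys; have [_ m2 _] := mF.
apply: measurable_col_mx; first exact: measurable_borel_mx mU (continuous_borel c1).
apply: measurable_mulmx; first exact: measurable_borel_mx mD m2.
exact: measurable_borel_mx mU (continuous_borel c2).
Qed.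

Lemma measurable_aug_h2 : measurable_mx (fun t => aug_h2 Sys (X t)).
Proof.
have [[_ _ _ c1] _] := cSys.
apply: measurable_col_mx; first exact: measurable_borel_mx mU (continuous_borel c1).
exact: measurable_mx_cst.
Qed.

Variable V : T -> 'cV[R]_nv.
Hypothesis mV : measurable_mx V.

(** [aug_step] is the drift plus [w] times the diffusion; the splitting isolates the dependence on
    the current noise. *)
Definition aug_drift t := aug_f1 Sys F (X t) + aug_h1 Sys F (X t) *m V t.
Definition aug_diffusion t := aug_f2 Sys (X t) + aug_h2 Sys (X t) *m V t.

Lemma measurable_aug_drift : measurable_mx aug_drift.
Proof.
apply: measurable_mxD; first exact: measurable_aug_f1.
by apply: measurable_mulmx => //; exact: measurable_aug_h1.
Qed.

Lemma measurable_aug_diffusion : measurable_mx aug_diffusion.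
Proof.
apply: measurable_mxD; first exact: measurable_aug_f2.
by apply: measurable_mulmx => //; exact: measurable_aug_h2.
Qed.

End augmented_measurability.

(** [qform_le2D], applied to the drift and to the diffusion, produces exactly the factors 2 in
    [2 * Theta1] and in [Theta2bar]. *)
Lemma aug_dissipation {R : realType} {n nv ny nz nxh : nat} {gamma : R}
    {Sys : plant R n nv ny nz} {F : estimator R nxh ny nz} {Q : 'M[R]_(n + nxh)}
    {eta : 'cV[R]_(n + nxh)} {v : 'cV[R]_nv} :
  sym_posdef Q ->
  2 * Theta1 Sys F Q eta + Theta2bar Sys F gamma Q eta v
    - qform Q eta + enorm (aug_m Sys F eta) ^+ 2 <= 0 ->
  qform Q (aug_f1 Sys F eta + aug_h1 Sys F eta *m v) +
  qform Q (aug_f2 Sys eta + aug_h2 Sys eta *m v) +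
  enorm (aug_m Sys F eta) ^+ 2 <= qform Q eta + gamma ^+ 2 * enorm v ^+ 2.
Proof.
move=> Q0.
have -> : Theta2bar Sys F gamma Q eta v =
    2 * qform Q (aug_h1 Sys F eta *m v) + 2 * qform Q (aug_h2 Sys eta *m v)
    - gamma ^+ 2 * enorm v ^+ 2.
  rewrite -!qform_congruence enorm_sqr /Theta2bar /qform.
  rewrite !(mulmxDr, mulmxDl, mulmxBr, mulmxBl) !mulmxN !mulNmx.
  by rewrite -!scalemxAr -!scalemxAl mul_mx_scalar -scalemxAl !mxE.
have := qform_le2D _ _ (aug_f1 Sys F eta) (aug_h1 Sys F eta *m v) Q0.
have := qform_le2D _ _ (aug_f2 Sys eta) (aug_h2 Sys eta *m v) Q0.
rewrite /Theta1; lra.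
Qed.

(** * One-step and finite-horizon energy estimates *)

Section energy.
Context {R : realType} {d} {Omega : measurableType d} {P : probability Omega R}.
Variable w : nat -> {RV P >-> R}.
Context {n nv ny nz nxh : nat}.
Variables (gamma : R) (Sys : plant R n nv ny nz) (F : estimator R nxh ny nz)
  (Q : 'M[R]_(n + nxh)).
Hypotheses (indep : mutually_independent w)
  (w_mean : forall i, ('E_P[w i] = 0)%E)
  (w_cov : forall i j, ('E_P[(w i \* w j)%R] = (i == j)%:R%:E)%E)
  (cSys : plant_continuous Sys) (mF : estimator_measurable F)
  (cU : continuous (fun eta => enorm (aug_m Sys F eta)))
  (Q_pos : sym_posdef Q)
  (dissip : forall (eta : 'cV[R]_(n + nxh)) (v : 'cV[R]_nv),
     2 * Theta1 Sys F Q eta + Theta2bar Sys F gamma Q eta v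
       - qform Q eta + enorm (aug_m Sys F eta) ^+ 2 <= 0).
Variables (v : nat -> Omega -> 'cV[R]_nv) (eta0 : 'cV[R]_(n + nxh)).
Hypothesis av : adapted w v.

Notation pastType k := (g_sigma_algebraType (past_generator w k)).
Notation eta := (aug_state Sys F w eta0 v).

Lemma past_measurable_v k : @measurable_mx R _ (pastType k) _ _ (v k).
Proof. apply: measurable_borel_entry => B mB; exact: av. Qed.

(** The index shift matters: F_k stops at [w (k - 1)], so [w k] enters only at time [k.+1]. *)
Lemma past_measurable_w k : @measurable_fun _ _ (pastType k.+1) R setT (w k).
Proof.
move=> _ B mB; rewrite setTI; apply: sub_sigma_algebra.
by apply/past_generatorP; exists k => //; exists B.
Qed.

Lemma past_measurable_incr k m p (X : Omega -> 'M[R]_(m, p)) :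
  @measurable_mx R _ (pastType k) _ _ X -> @measurable_mx R _ (pastType k.+1) _ _ X.
Proof.
move=> mX i j _ B mB; rewrite setTI; apply: past_incr.
by have := mX i j measurableT B mB; rewrite setTI.
Qed.

Lemma past_measurable_mx k m p (X : Omega -> 'M[R]_(m, p)) :
  @measurable_mx R _ (pastType k) _ _ X -> measurable_mx X.
Proof.
move=> mX i j _ B mB; rewrite setTI; apply: (@past_sub_measurable _ _ _ _ w k).
by have := mX i j measurableT B mB; rewrite setTI.
Qed.

(** The state at time [k] involves the noise and the adapted input only up to time [k - 1]; hence it
    is independent of [w k]. *)
Lemma past_measurable_state k : @measurable_mx R _ (pastType k) _ _ (eta k).
Proof.
elim: k => [|k IH]; first exact: measurable_mx_cst.
rewrite /= /aug_step.
have mv := past_measurable_v k.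
apply: measurable_mxD.
  by apply: past_measurable_incr; exact: measurable_aug_drift.
apply: measurable_mxZ; first exact: past_measurable_w.
by apply: past_measurable_incr; exact: measurable_aug_diffusion.
Qed.

Lemma measurable_state k : measurable_mx (eta k).
Proof. exact: past_measurable_mx (past_measurable_state k). Qed.

Lemma measurable_v k : measurable_mx (v k).
Proof. exact: past_measurable_mx (past_measurable_v k). Qed.

Lemma measurable_output k :
  measurable_fun setT (fun om => enorm (aug_m Sys F (eta k om))).
Proof. exact: measurable_continuous_mx (measurable_state k) cU. Qed.

(* Given the past, the affine-in-[w k] successor state has conditional second
   moment [qform drift + qform diffusion]: independence freezes drift and
   diffusion, and [w k] has mean 0 and variance 1. *)
Lemma expectation_qform_step k :
  (\int[P]_om (qform Q (eta k.+1 om))%:E =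
   \int[P]_om (qform Q (aug_drift Sys F (eta k) (v k) om) +
               qform Q (aug_diffusion Sys (eta k) (v k) om))%:E)%E.
Proof.
set D := aug_drift _ _ _ _; set G := aug_diffusion _ _ _.
have mD : @measurable_mx R _ (pastType k) _ _ D.
  by apply: measurable_aug_drift => //;
    [exact: past_measurable_state|exact: past_measurable_v].
have mG : @measurable_mx R _ (pastType k) _ _ G.
  by apply: measurable_aug_diffusion => //;
    [exact: past_measurable_state|exact: past_measurable_v].
pose b om := ((D om)^T *m Q *m G om) 0 0 + ((G om)^T *m Q *m D om) 0 0.
(* The quadratic is written out in powers of the noise, so that joint measurability reduces to that
   of its F_k-measurable coefficients. *)
pose g (z : Omega * R) : \bar R :=
  (qform Q (D z.1) + b z.1 * z.2 + qform Q (G z.1) * z.2 ^+ 2)%:E.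
have gE om y : g (om, y) = (qform Q (D om + y *: G om))%:E.
  by rewrite qform_shift.
transitivity (\int[P]_om g (om, w k om))%E.
  by apply: eq_integral => om _; rewrite gE.
rewrite integral_past_indep//; last first.
  by move=> [om y]; rewrite gE lee_fin qform_ge0.
  apply/measurable_EFinP.
  have mfst (f : Omega -> R) : @measurable_fun _ _ (pastType k) R setT f ->
      @measurable_fun _ _ (pastType k * R)%type R setT (fun z => f z.1).
    by move=> mf; exact: measurableT_comp mf measurable_fst.
  apply: measurable_funD; first apply: measurable_funD.
  - by apply: (mfst (fun om => qform Q (D om))); exact: measurable_bilinear.
  - apply: measurable_funM => //; apply: (mfst b).
    by apply: measurable_funD; exact: measurable_bilinear.
  - apply: measurable_funM; last exact: measurable_funX.
    by apply: (mfst (fun om => qform Q (G om))); exact: measurable_bilinear.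
apply: eq_integral => om _.
rewrite /g /= integral_standardized_quadratic//.
by rewrite w_cov eqxx.
Qed.

(** Integrates [aug_dissipation]. Every term is nonnegative and enters with a plus sign, so the
    integrals add up in the extended reals without a finiteness condition. *)
Lemma energy_step k :
  (\int[P]_om (qform Q (eta k.+1 om))%:E +
   \int[P]_om (enorm (aug_m Sys F (eta k om)) ^+ 2)%:E <=
   \int[P]_om (qform Q (eta k om))%:E +
   (gamma ^+ 2)%:E * \int[P]_om (enorm (v k om) ^+ 2)%:E)%E.
Proof.
have mq (X : Omega -> 'cV[R]_(n + nxh)) : measurable_mx X ->
    measurable_fun setT (fun om => (qform Q (X om))%:E).
  by move=> mX; apply/measurable_EFinP; exact: measurable_bilinear.
have mout : measurable_fun setT (fun om => (enorm (aug_m Sys F (eta k om)) ^+ 2)%:E).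
  by apply/measurable_EFinP; apply: measurable_funX; exact: measurable_output.
have mv : measurable_fun setT (fun om => (enorm (v k om) ^+ 2)%:E).
  by apply/measurable_EFinP; apply: measurable_enorm_sqr; exact: measurable_v.
have sqr_ge0E (x : R) : (0 <= (x ^+ 2)%:E)%E by rewrite lee_fin sqr_ge0.
have q_ge0E x : (0 <= (qform Q x)%:E)%E by rewrite lee_fin qform_ge0.
rewrite expectation_qform_step.
have mDG : measurable_fun setT (fun om =>
    (qform Q (aug_drift Sys F (eta k) (v k) om) +
     qform Q (aug_diffusion Sys (eta k) (v k) om))%:E).
  have ms := measurable_state k; have mvk := measurable_v k.
  have mD := measurable_aug_drift Sys F cSys mF _ ms _ mvk.
  have mG := measurable_aug_diffusion Sys cSys _ ms _ mvk.
  by apply/measurable_EFinP; apply: measurable_funD;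
    [exact: (measurable_bilinear _ _ _ Q mD mD)|exact: (measurable_bilinear _ _ _ Q mG mG)].
rewrite -ge0_integralZl// -!ge0_integralD//; first last.
- by move=> om _; rewrite lee_fin addr_ge0 ?qform_ge0.
- exact: measurable_funeM.
- by move=> om _; rewrite mule_ge0.
- by apply: (mq (eta k)); exact: measurable_state.
apply: ge0_le_integral => //.
- by move=> om _; rewrite adde_ge0// lee_fin addr_ge0 ?qform_ge0.
- exact: emeasurable_funD.
- apply: emeasurable_funD; last exact: measurable_funeM.
  by apply: (mq (eta k)); exact: measurable_state.
- move=> om _; rewrite -EFinM -!EFinD lee_fin.
  exact: aug_dissipation.
Qed.

Lemma energy_bound N :
  (\sum_(0 <= k < N) \int[P]_om (enorm (aug_m Sys F (eta k om)) ^+ 2)%:E <=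
   (qform Q eta0)%:E +
   (gamma ^+ 2)%:E * \sum_(0 <= k < N) \int[P]_om (enorm (v k om) ^+ 2)%:E)%E.
Proof.
(* The induction needs the terminal storage on the left; being nonnegative, it is dropped at the
   end. *)
suff : (\int[P]_om (qform Q (eta N om))%:E +
   \sum_(0 <= k < N) \int[P]_om (enorm (aug_m Sys F (eta k om)) ^+ 2)%:E <=
   (qform Q eta0)%:E +
   (gamma ^+ 2)%:E * \sum_(0 <= k < N) \int[P]_om (enorm (v k om) ^+ 2)%:E)%E.
  apply: le_trans; rewrite leeDr// integral_ge0// => om _.
  by rewrite lee_fin qform_ge0.
have iv k : (0 <= \int[P]_om (enorm (v k om) ^+ 2)%:E)%E.
  by apply: integral_ge0 => om _; rewrite lee_fin sqr_ge0.
elim: N => [|N IH].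
  rewrite !big_geq// mule0 !adde0 /=.
  by rewrite -[leRHS]mule1 -(probability_setT P) -integral_cst.
rewrite !big_nat_recr//= ge0_muleDr//; last exact: sume_ge0.
rewrite [leRHS]addeA; apply: le_trans (leeD2r _ IH).
rewrite [leLHS]addeA [leLHS]addeAC [leRHS]addeAC; apply: leeD2r.
exact: energy_step.
Qed.

End energy.

(** * Lower bounds away from the origin *)

Section euclidean_topology.
Context {R : realType}.

Lemma entry_le_enorm n (x : 'cV[R]_n) i j : `|x i j| <= enorm x.
Proof.
rewrite -sqrtr_sqr; apply: ler_wsqrtr; rewrite (ord1 j) (bigD1 i)//=.
by rewrite lerDl; apply: sumr_ge0 => k _; exact: sqr_ge0.
Qed.

Lemma enorm0 n : enorm (0 : 'cV[R]_n) = 0.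
Proof.
by rewrite /enorm big1 ?sqrtr0// => i _; rewrite mxE expr0n.
Qed.

Lemma enorm_continuous n : continuous (@enorm R n).
Proof.
move=> x; apply: continuous_comp; last exact: sqrt_continuous.
apply: (@continuous_big _ _ _ _ _ (@add_continuous R^o)) => i _ y.
apply: (@continuous_comp _ _ _ (fun x : 'cV[R]_n => x i 0) (fun r : R => r ^+ 2)).
  exact: coord_continuous.
exact: exprn_continuous.
Qed.

Lemma qform_continuous n (Q : 'M[R]_n) : continuous (qform Q).
Proof.
have -> : qform Q = (fun x => \sum_(j < n) (\sum_(i < n) x i 0 * Q i j) * x j 0).
  apply/funext => x; rewrite /qform mxE; apply: eq_bigr => j _.
  by rewrite mxE; congr (_ * _); apply: eq_bigr => i _; rewrite mxE.
have cQ j : continuous (fun x : 'cV[R]_n => \sum_(i < n) x i 0 * Q i j).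
  apply: (@continuous_big _ _ _ _ _ (@add_continuous R^o)) => i _ x.
  apply: (@continuousM _ _ (fun x : 'cV[R]_n => x i 0) (cst (Q i j))).
    exact: coord_continuous.
  exact: cst_continuous.
apply: (@continuous_big _ _ _ _ _ (@add_continuous R^o)) => j _ x.
apply: (@continuousM _ _ (fun x : 'cV[R]_n => \sum_(i < n) x i 0 * Q i j)
  (fun x : 'cV[R]_n => x j 0)); first exact: cQ.
exact: coord_continuous.
Qed.

Lemma trmx_continuous m n : continuous (@trmx R m n).
Proof.
move=> A B [P AP PB]; exists (fun i j => P j i) => [i j|M MP /=].
  by have := AP j i; rewrite mxE.
by apply: PB => i j; rewrite mxE; exact: MP.
Qed.

(** A closed subset of a compact box. Row vectors are used to match [rV_compact]; [trmx] carries the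
    result to columns. *)
Lemma compact_enorm_shell n (a b : R) :
  compact [set y : 'rV[R]_n | a <= enorm y^T <= b].
Proof.
pose box : set 'rV[R]_n := [set y | forall i, `[- b, b]%classic (y ord0 i)].
have -> : [set y : 'rV[R]_n | a <= enorm y^T <= b] =
          box `&` ((fun y : 'rV[R]_n => enorm y^T) @^-1` `[a, b]%classic).
  apply/seteqP; split => y /=; last by rewrite in_itv/= => -[].
  move=> yab; split; last by rewrite in_itv.
  move=> i /=; rewrite in_itv/= -ler_norml.
  case/andP: yab => _; apply: le_trans.
  by have := entry_le_enorm _ y^T i ord0; rewrite mxE.
apply: compact_closedI.
  apply: (@rV_compact R n (fun=> `[- b, b]%classic)) => i.
  exact: segment_compact.
apply: preimage_closed; last exact: itv_closed.
move=> y _; apply: (@continuous_comp _ _ _ trmx); first exact: trmx_continuous.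
exact: enorm_continuous.
Qed.

(** Beyond some radius [r], [U] exceeds 1; on the compact shell between [e] and [r] it attains a
    positive minimum. The smaller of the two bounds is [delta]. *)
Lemma positive_radially_unbounded_lower_bound {n} {U : 'cV[R]_n -> R} {e : R} :
  continuous U -> positive_radially_unbounded U -> 0 < e ->
  exists2 delta, 0 < delta & forall x, e <= enorm x -> delta <= U x.
Proof.
move=> cU [_ U_gt0 Uoo] e0.
have [r r1] : exists r, forall x, r < enorm x -> 1 < U x.
  have : (1%:E < limf_einf (fun x => (U x)%:E) (@enorm_infty R n))%E.
    by rewrite Uoo ltry.
  rewrite limf_einfE => /ereal_sup_gt[_ [A [r _ rA] <-]] inf1.
  exists r => x rx; rewrite -lte_fin; apply: lt_le_trans inf1 _.
  by apply: ereal_inf_lbound; exists x => //; exact: rA.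
pose K := [set y : 'rV[R]_n | e <= enorm y^T <= r].
(* The shell is empty when [r < e] or [n = 0]; no point with norm at least [e] then has norm at most
   [r], and the bound 1 suffices. *)
have [K0|/set0P/negP/negPn/eqP K0] := pselect (K !=set0); last first.
  exists 1 => // x ex; apply/ltW/r1; rewrite ltNge; apply/negP => xr.
  suff : K x^T by rewrite K0.
  by rewrite /K /= trmxK ex.
have [|c cK cmin] := compact_EVT_min (f := fun y => U y^T) K0 (compact_enorm_shell _ _ _).
  apply: continuous_subspaceT => y.
  by apply: (@continuous_comp _ _ _ trmx); [exact: trmx_continuous|exact: cU].
have Uc : 0 < U c^T.
  apply: U_gt0; apply/eqP => c0; move/set_mem: cK; rewrite /K /= c0 enorm0.
  by rewrite leNgt e0.
exists (Num.min 1 (U c^T)); first by rewrite lt_min ltr01.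
move=> x ex; rewrite ge_min; have [xr|/r1/ltW->//] := leP (enorm x) r.
by apply/orP; right; have := cmin x^T; rewrite trmxK; apply; apply/mem_set; rewrite /K /= trmxK ex.
Qed.

Lemma enorm_cvg0 n (x : nat -> 'cV[R]_n) :
  (forall e, 0 < e -> \forall k \near \oo, enorm (x k) < e) ->
  x k @[k --> \oo] --> (0 : 'cV[R]_n).
Proof.
move=> xe; apply/cvg_ballP => e e0; near=> k.
split => // i j; rewrite mxE -ball_normE /= sub0r normrN.
apply: (le_lt_trans (entry_le_enorm _ _ _ _)).
by near: k; exact: xe.
Unshelve. all: by end_near. Qed.

End euclidean_topology.

(** * Stability *)

Section stability.
Context {R : realType} {d} {Omega : measurableType d} {P : probability Omega R}.
Variable w : nat -> {RV P >-> R}.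
Context {n nv ny nz nxh : nat}.
Variables (gamma : R) (Sys : plant R n nv ny nz) (F : estimator R nxh ny nz)
  (Q : 'M[R]_(n + nxh)).
Hypotheses (indep : mutually_independent w)
  (w_mean : forall i, ('E_P[w i] = 0)%E)
  (w_cov : forall i j, ('E_P[(w i \* w j)%R] = (i == j)%:R%:E)%E)
  (cSys : plant_continuous Sys) (mF : estimator_measurable F)
  (cU : continuous (fun eta => enorm (aug_m Sys F eta)))
  (Q_pos : sym_posdef Q)
  (dissip : forall (eta : 'cV[R]_(n + nxh)) (v : 'cV[R]_nv),
     2 * Theta1 Sys F Q eta + Theta2bar Sys F gamma Q eta v
       - qform Q eta + enorm (aug_m Sys F eta) ^+ 2 <= 0).

Let energy v eta0 om : \bar R :=
  (\sum_(0 <= k <oo) (enorm (aug_m Sys F (aug_state Sys F w eta0 v k om)) ^+ 2)%:E)%E.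

Let sqrE_ge0 (x : R) : (0 <= (x ^+ 2)%:E)%E.
Proof. by rewrite lee_fin sqr_ge0. Qed.

Lemma measurable_output_sqr v eta0 k : adapted w v ->
  measurable_fun setT
    (fun om => (enorm (aug_m Sys F (aug_state Sys F w eta0 v k om)) ^+ 2)%:E).
Proof.
by move=> av; apply/measurable_EFinP; apply: measurable_funX; exact: measurable_output.
Qed.

(** Nonnegative terms allow expectation and series to be exchanged; [energy_bound] then passes to
    the limit in the horizon. *)
Lemma output_energy_bound v eta0 : adapted w v ->
  (sqr_l2norm P (fun k om => aug_m Sys F (aug_state Sys F w eta0 v k om)) <=
   (qform Q eta0)%:E + (gamma ^+ 2)%:E * sqr_l2norm P v)%E.
Proof.
move=> av; rewrite /sqr_l2norm integral_nneseries//; last first.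
  by move=> k; exact: measurable_output_sqr.
rewrite [in leRHS]integral_nneseries//; last first.
  move=> k; apply/measurable_EFinP; apply: measurable_enorm_sqr.
  exact: measurable_v av k.
apply: lime_le; first by apply: is_cvg_nneseries => k _ _; exact: integral_ge0.
apply: nearW => N.
apply: le_trans (energy_bound _ gamma _ _ _ indep w_mean w_cov cSys mF cU Q_pos dissip _ _ av N) _.
apply: leeD2l; apply: lee_wpmul2l => //.
by apply: nneseries_lim_ge => k _ _; exact: integral_ge0.
Qed.

Lemma external_stability : externally_stable Sys F w gamma.
Proof.
move=> v [av _] _; have := output_energy_bound v 0 av.
by rewrite [qform Q 0]/qform mulmx0 mxE add0e.
Qed.

Lemma adapted0 : adapted w (fun _ _ => 0 : 'cV[R]_nv).
Proof.
move=> k B _.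
have [B0|B0] := pselect (B 0).
  rewrite (_ : _ @^-1` B = setT); last by apply/seteqP; split.
  exact: (@measurableT _ (g_sigma_algebraType (past_generator w k))).
rewrite (_ : _ @^-1` B = set0); last by apply/seteqP; split.
exact: (@measurable0 _ (g_sigma_algebraType (past_generator w k))).
Qed.

Let free_energy eta0 := energy (fun _ _ => 0) eta0.

Let measurable_free_energy eta0 : measurable_fun setT (free_energy eta0).
Proof.
apply: ge0_emeasurable_sum => // k _; apply: measurable_output_sqr.
exact: adapted0.
Qed.

Let free_energy_ge0 eta0 om : (0 <= free_energy eta0 om)%E.
Proof. exact: nneseries_ge0. Qed.

Let integral_free_energy eta0 :
  (\int[P]_om free_energy eta0 om <= (qform Q eta0)%:E)%E.
Proof.
apply: (le_trans (output_energy_bound _ eta0 adapted0)).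
have -> : sqr_l2norm P (fun _ _ => 0 : 'cV[R]_nv) = 0%E.
  rewrite /sqr_l2norm -[RHS](integral0 P setT); apply: eq_integral => om _.
  by apply: eseries0 => k _ _; rewrite enorm0 expr0n.
by rewrite mule0 adde0.
Qed.

Lemma lyapunov_stability eps :
  positive_radially_unbounded (fun eta => enorm (aug_m Sys F eta)) -> 0 < eps ->
  P [set om | (eps%:E < ereal_sup [set (enorm (aug_state Sys F w eta0 (fun _ _ => 0) k om))%:E
                                  | k in [set: nat]])%E]
    @[eta0 --> (0 : 'cV[R]_(n + nxh))^'] --> 0%E.
Proof.
move=> Upos eps0.
have [delta delta0 Udelta] := positive_radially_unbounded_lower_bound cU Upos eps0.
have delta20 : 0 < delta ^+ 2 by rewrite exprn_gt0.
(* The upper function is Markov's bound on the total output energy at threshold [delta ^+ 2]. *)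
apply: (@squeeze_cvge _ _ _ _ (cst 0%E) _ (fun eta0 => ((delta ^+ 2)^-1 * qform Q eta0)%:E)).
- near=> eta0.
  set A := [set om | _]; rewrite measure_ge0//=.
  pose sol := aug_state Sys F w eta0 (fun _ _ => 0).
  (* A supremum exceeds [eps] exactly when some term does; the countable union gives
     measurability. *)
  have AE : A = \bigcup_k [set om | eps < enorm (sol k om)].
    apply/seteqP; split => om /=.
      by move=> /ereal_sup_gt[_ [k _ <-]]; rewrite lte_fin => ?; exists k.
    move=> [k _ /= ek]; apply: (@lt_le_trans _ _ (enorm (sol k om))%:E) => //.
    by apply: ereal_sup_ubound; exists k.
  have mA : measurable A.
    rewrite AE; apply: bigcupT_measurable => k.
    have ms : measurable_fun setT (fun om => enorm (sol k om)).
      apply: measurable_continuous_mx; last exact: enorm_continuous.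
      exact: measurable_state adapted0 k.
    have := ms measurableT _ (measurable_itv `]eps, +oo[).
    by rewrite setTI set_itvoy.
  (* A single exit from the ball already contributes [delta ^+ 2] to the energy. *)
  have AS : A `<=` [set om | ((delta ^+ 2)%:E <= `|free_energy eta0 om|)%E].
    rewrite AE => om [k _ /= ek]; rewrite gee0_abs//.
    apply: le_trans (nneseries_lim_ge k.+1 _) => //.
    rewrite big_nat_recr//=; apply: (@le_trans _ _ (enorm (aug_m Sys F (sol k om)) ^+ 2)%:E).
      by rewrite lee_fin; apply: lerXn2r; rewrite ?nnegrE;
        [exact: ltW|exact: sqrtr_ge0|exact/Udelta/ltW].
    by rewrite leeDr// sume_ge0.
  rewrite EFinM lee_pdivlMl//.
  apply: le_trans (integral_free_energy eta0).
  have -> : (\int[P]_om free_energy eta0 om = \int[P]_om `|free_energy eta0 om|)%E.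
    by apply: eq_integral => om _; rewrite gee0_abs.
  apply: le_trans (le_integral_abse P measurableT (measurable_free_energy eta0) delta20).
  rewrite setTI; apply: lee_wpmul2l => //.
  apply: le_measure AS; apply: mem_set => //.
  have mabs : measurable_fun setT (fun om => `|free_energy eta0 om|%E).
    exact: measurableT_comp.
  have := emeasurable_fun_c_infty measurableT mabs (delta ^+ 2)%:E.
  by rewrite setTI.
- exact: cvg_cst.
- apply: cvg_EFin; first exact: nearW.
  apply: cvg_within_filter.
  have qc : continuous (fun eta0 => (delta ^+ 2)^-1 * qform Q eta0).
    move=> x; apply: (@continuousM _ _ (cst (delta ^+ 2)^-1) (qform Q)).
      exact: cst_continuous.
    exact: qform_continuous.
  have := qc 0; rewrite /continuous_at {2}/qform mulmx0 mxE mulr0; exact.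
Unshelve. all: by end_near. Qed.

Lemma almost_sure_attraction eta0 :
  measure_is_complete P ->
  positive_radially_unbounded (fun eta => enorm (aug_m Sys F eta)) ->
  P [set om | aug_state Sys F w eta0 (fun _ _ => 0) k om @[k --> \oo] -->
              (0 : 'cV[R]_(n + nxh))] = 1%E.
Proof.
move=> cP Upos; set A := [set om | _].
have int_energy : P.-integrable setT (free_energy eta0).
  apply/integrableP; split => //.
  under eq_integral do rewrite gee0_abs//.
  by apply: le_lt_trans (integral_free_energy eta0) _; rewrite ltry.
have : P.-negligible (~` A).
  (* One null set, where the energy is infinite, serves all radii [e] at once. *)
  apply: negligibleS (integrable_ae measurableT int_energy) => om /= nA fin.
  apply: nA; apply: enorm_cvg0 => e e0.
  have [delta delta0 Udelta] := positive_radially_unbounded_lower_bound cU Upos e0.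
  have Eoo : (free_energy eta0 om < +oo)%E by rewrite ltey_eq fin.
  have delta20 : (0 < (delta ^+ 2)%:E)%E by rewrite lte_fin exprn_gt0.
  (* Once the tail from [k] on is below [delta ^+ 2], its first term forbids the state at time [k]
     from lying outside the ball. *)
  have := nneseries_tail_cvg Eoo (fun k _ => sqrE_ge0 _).
  move=> /fine_cvgP[tail_fin /cvgr_lt tail_lt].
  near=> k; rewrite ltNge; apply/negP => ek.
  have : ((delta ^+ 2)%:E <= \sum_(k <= i <oo)
      (enorm (aug_m Sys F (aug_state Sys F w eta0 (fun _ _ => 0%R) i om)) ^+ 2)%:E)%E.
    apply: le_trans (nneseries_lim_ge k.+1 _) => //.
    rewrite big_nat1 lee_fin; apply: lerXn2r; rewrite ?nnegrE;
      [exact: ltW|exact: sqrtr_ge0|exact: Udelta].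
  apply/negP; rewrite -ltNge -[ltLHS]fineK; last by near: k; exact: tail_fin.
  by rewrite lte_fin; near: k; apply: tail_lt; rewrite -lte_fin.
(* Completeness makes the negligible complement measurable, so that its probability is 0 and that of
   [A] is 1. *)
move=> nA; have mA : measurable (~` A) by exact: cP.
have /(negligibleP P mA) PA0 := nA.
have := probability_setC P mA; rewrite setCK PA0 sube0; exact.
Unshelve. all: by end_near. Qed.

End stability.

Theorem theorem2 (R : realType) (d : measure_display) (Omega : measurableType d)
    (P : probability Omega R) (w : nat -> {RV P >-> R})
    (n nv ny nz nxh : nat) (gamma : R)
    (Sys : plant R n nv ny nz) (F : estimator R nxh ny nz)
    (Q : 'M[R]_(n + nxh)) :
  measure_is_complete P ->
  mutually_independent w ->
  (forall i, 'E_P[w i] = 0)%E ->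
  (forall i j, 'E_P[(w i \* w j)%R] = (i == j)%:R%:E)%E ->
  0 < gamma ->
  plant_continuous Sys ->
  plant_vanishing Sys ->
  estimator_measurable F ->
  continuous (fun eta => enorm (aug_m Sys F eta)) ->
  positive_radially_unbounded (fun eta => enorm (aug_m Sys F eta)) ->
  sym_posdef Q ->
  (forall (eta : 'cV[R]_(n + nxh)) (v : 'cV[R]_nv),
     2 * Theta1 Sys F Q eta + Theta2bar Sys F gamma Q eta v
       - qform Q eta + enorm (aug_m Sys F eta) ^+ 2 <= 0) ->
  Hinf_filter Sys F w gamma.
Proof.
move=> cP indep w_mean w_cov _ cSys _ mF cU Upos Q_pos dissip; split; first split.
- move=> eps eps0.
  exact: (lyapunov_stability _ _ _ _ _ indep w_mean w_cov cSys mF cU Q_pos dissip).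
- move=> eta0.
  exact: (almost_sure_attraction _ _ _ _ _ indep w_mean w_cov cSys mF cU Q_pos dissip).
- exact: (external_stability _ _ _ _ _ indep w_mean w_cov cSys mF cU Q_pos dissip).
Qed.
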